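(* Let $\mathbb F$ be a field of characteristic different from $2$ and $3$, let $(U,xyz)$ be a $(1,1)$ Freudenthal-Kantor triple system over $\mathbb F$, and let $K(U,U)\subseteq\mathrm{End}_{\mathbb F}(U)$ be the linear span of the operators $K(x,y)$, $x,y\in U$. Then $\bigl(K(U,U)\oplus U,\bar{\ },*,\{\cdot,\cdot,\cdot\}\bigr)$ is a dicyclic ternary algebra, where $$\bar M=M,\quad \bar x=-x,$$ $$M_1*M_2=0,\quad M*x=Mx,\quad x_1*x_2=-K(x_1,x_2)$$ (with $x*M=-M*x$), $$\{M_1,x_1,M_2\}=\{M_1,x_1,x_2\}=\{x_1,M_1,M_2\}=\{x_1,M_1,x_2\}=0,$$ $$\{M_1,M_2,M_3\}=-(M_1M_2M_3+M_3M_2M_1),\quad \{M_1,M_2,x\}=M_2M_1x,$$ $$\{x_1,x_2,M\}=K(Mx_1,x_2),\quad \{x_1,x_2,x_3\}=x_1x_2x_3,$$ for any $x,x_1,x_2,x_3\in U$ and $M,M_1,M_2,M_3\in K(U,U)$.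
   Context: A $(1,1)$ Freudenthal-Kantor triple system is a vector space $U$ with a trilinear product $xyz$ such that, with $L(x,y)z=xyz$ and $K(x,y)z=xzy-yzx$, for all $x,y,u,v\in U$: $[L(u,v),L(x,y)]=L(L(u,v)x,y)+L(x,L(v,u)y)$ and $K(K(u,v)x,y)=L(y,x)K(u,v)-K(u,v)L(x,y)$. A dicyclic ternary algebra $(A,\bar{\ },*,\{\ldots\})$ is a vector space with a linear map $x\mapsto\bar x$, a bilinear anticommutative product $x*y$ and a trilinear product $\{x,y,z\}$ such that $\bar{\bar x}=x$, $\overline{x*y}=\bar x*\bar y$, $\overline{\{x,y,z\}}=\{\bar x,\bar y,\bar z\}$ and, for all elements: (D1) $\{x,z,y\}-\{y,z,x\}=(\bar x*\bar y)*\bar z$; (D2) $\{u,\bar v,x*y\}+\{v,u,x\}*y+x*\{v,u,y\}=0$; (D3) $\{x,y*z,w\}+\{y,z*x,w\}+\{z,x*y,w\}=0$; (D4) $\{\bar x*\bar y,z,w\}+\{\bar y*\bar z,x,w\}+\{\bar z*\bar x,y,w\}=0$; (D5) $\{u,v,\{x,y,z\}\}=\{\{u,v,x\},y,z\}-\{x,\{v,\bar u,y\},z\}+\{x,y,\{u,v,z\}\}$. *)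

(* Defs.v *)
From HB Require Import structures.
From mathcomp Require Import all_boot all_order all_algebra.
From mathcomp Require Import boolp classical_sets functions.
Set Implicit Arguments.
Unset Strict Implicit.
Unset Printing Implicit Defensive.
Import GRing.Theory.
Local Open Scope ring_scope.

Definition bilinear_op (F : fieldType) (A : lmodType F) (m : A -> A -> A) :=
  (forall y, linear (fun x => m x y)) /\ (forall x, linear (fun y => m x y)).

Definition trilinear_op (F : fieldType) (A : lmodType F)
    (t : A -> A -> A -> A) :=
  [/\ forall y z, linear (fun x => t x y z),
      forall x z, linear (fun y => t x y z)
    & forall x y, linear (fun z => t x y z)].

Section OperatorsLK.
Context (F : fieldType) (U : lmodType F) (t : U -> U -> U -> U).

Definition opL (x y : U) : U -> U := fun z => t x y z.
Definition opK (x y : U) : U -> U := fun z => t x z y - t y z x.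

(* Sums and differences of operators are those of the function space U -> U. *)
Record is_FK11 : Prop := {
  FK11_trilinear : trilinear_op t;
  FK11_LL : forall x y u v : U,
    (opL u v \o opL x y) - (opL x y \o opL u v)
      = opL (opL u v x) y + opL x (opL v u y);
  FK11_KL : forall x y u v : U,
    opK (opK u v x) y = (opL y x \o opK u v) - (opK u v \o opL x y) }.

(* The linear span of the opK x y, taken in the space of all functions U -> U. *)
(* By K_space_linear below, its members are endomorphisms when t is trilinear, *)
(* so this is also their span in End(U).                                       *)
Definition K_span : pred (U -> U) := fun f =>
  `[< exists n (a : 'I_n -> F) (x y : 'I_n -> U),
        f = \sum_(i < n) a i *: opK (x i) (y i) >].

Lemma K_span_submod_closed : submod_closed K_span.
Proof.
split.
  apply/asboolP; exists 0%N, (fun=> 0), (fun=> 0), (fun=> 0).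
  by rewrite big_ord0.
move=> c f g /asboolP[n [a [x [y ->]]]] /asboolP[m [b [z [w ->]]]].
pose cat T (p : 'I_n -> T) (q : 'I_m -> T) (i : 'I_(n + m)) :=
  match fintype.split i with inl j => p j | inr k => q k end.
apply/asboolP; exists (n + m)%N, (cat _ (fun i => c * a i) b), (cat _ x z), (cat _ y w).
rewrite big_split_ord /= scaler_sumr; congr (_ + _).
  apply: eq_bigr => i _; rewrite /cat.
  by rewrite (unsplitK (inl i) : fintype.split (lshift m i) = _) scalerA.
apply: eq_bigr => i _; rewrite /cat.
by rewrite (unsplitK (inr i) : fintype.split (rshift n i) = _).
Qed.

HB.instance Definition _ :=
  GRing.isSubmodClosed.Build F (U -> U) K_span K_span_submod_closed.

Lemma opK_in_K_span x y : opK x y \in K_span.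
Proof.
apply/asboolP; exists 1%N, (fun=> 1), (fun=> x), (fun=> y).
by rewrite big_ord1 scale1r.
Qed.

Record K_space := KSpace {
  K_space_val :> U -> U;
  K_space_valP : K_space_val \in K_span }.

HB.instance Definition _ := [isSub for K_space_val].
HB.instance Definition _ := [Choice of K_space by <:].
HB.instance Definition _ := [SubChoice_isSubLmodule of K_space by <:].

Definition opKs (x y : U) : K_space := KSpace (opK_in_K_span x y).

Lemma K_space_linear (M : K_space) : trilinear_op t -> linear M.
Proof.
case=> _ linm _; case: M => f /= /asboolP[n [a [x [y ->]]]] c u v.
rewrite !fct_sumE scaler_sumr -big_split; apply: eq_bigr => i _ /=.
rewrite !fctE /opK !linm !scalerA -mulrC -scalerA -scalerDr; congr (_ *: _).
by rewrite scalerBr opprD addrACA.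
Qed.

Definition inK (M : K_space) : (K_space * U)%type := (M, 0).
Definition inU (x : U) : (K_space * U)%type := (0, x).

End OperatorsLK.

Record is_dicyclic_ternary_algebra (F : fieldType) (A : lmodType F)
    (bar : A -> A) (star : A -> A -> A) (trip : A -> A -> A -> A) : Prop := {
  dta_bar_linear : linear bar;
  dta_star_bilinear : bilinear_op star;
  dta_star_anticomm : forall x y, star x y = - star y x;
  dta_trip_trilinear : trilinear_op trip;
  dta_barK : forall x, bar (bar x) = x;
  dta_bar_star : forall x y, bar (star x y) = star (bar x) (bar y);
  dta_bar_trip : forall x y z,
    bar (trip x y z) = trip (bar x) (bar y) (bar z);
  dta_D1 : forall x y z,
    trip x z y - trip y z x = star (star (bar x) (bar y)) (bar z);
  dta_D2 : forall u v x y,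
    trip u (bar v) (star x y) + star (trip v u x) y + star x (trip v u y) = 0;
  dta_D3 : forall x y z w,
    trip x (star y z) w + trip y (star z x) w + trip z (star x y) w = 0;
  dta_D4 : forall x y z w,
    trip (star (bar x) (bar y)) z w + trip (star (bar y) (bar z)) x w
      + trip (star (bar z) (bar x)) y w = 0;
  dta_D5 : forall u v x y z,
    trip u v (trip x y z)
      = trip (trip u v x) y z - trip x (trip v (bar u) y) z
        + trip x y (trip u v z) }.

(* The (multi)linear operations on K(U,U) (+) U given by their values on the   *)
(* two summands. In FKop_trip_KKK the value has to lie in K(U,U).              *)
Record is_FK_operations (F : fieldType) (U : lmodType F)
    (t : U -> U -> U -> U)
    (bar : K_space t * U -> K_space t * U)
    (star : K_space t * U -> K_space t * U -> K_space t * U)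
    (trip : K_space t * U -> K_space t * U -> K_space t * U -> K_space t * U)
    : Prop := {
  FKop_bar_linear : linear bar;
  FKop_star_bilinear : bilinear_op star;
  FKop_trip_trilinear : trilinear_op trip;
  FKop_bar_K : forall M, bar (inK M) = inK M;
  FKop_bar_U : forall x, bar (inU t x) = inU t (- x);
  FKop_star_KK : forall M1 M2, star (inK M1) (inK M2) = 0;
  FKop_star_KU : forall M x, star (inK M) (inU t x) = inU t (M x);
  FKop_star_UK : forall M x,
    star (inU t x) (inK M) = - star (inK M) (inU t x);
  FKop_star_UU : forall x1 x2,
    star (inU t x1) (inU t x2) = inK (- opKs t x1 x2);
  FKop_trip_KUK : forall M1 x1 M2, trip (inK M1) (inU t x1) (inK M2) = 0;
  FKop_trip_KUU : forall M1 x1 x2, trip (inK M1) (inU t x1) (inU t x2) = 0;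
  FKop_trip_UKK : forall x1 M1 M2, trip (inU t x1) (inK M1) (inK M2) = 0;
  FKop_trip_UKU : forall x1 M1 x2, trip (inU t x1) (inK M1) (inU t x2) = 0;
  FKop_trip_KKK : forall M1 M2 M3,
    exists2 N : K_space t,
      trip (inK M1) (inK M2) (inK M3) = inK N &
      N = - ((M1 \o M2 \o M3) + (M3 \o M2 \o M1)) :> (U -> U);
  FKop_trip_KKU : forall M1 M2 x,
    trip (inK M1) (inK M2) (inU t x) = inU t (M2 (M1 x));
  FKop_trip_UUK : forall x1 x2 M,
    trip (inU t x1) (inU t x2) (inK M) = inK (opKs t (M x1) x2);
  FKop_trip_UUU : forall x1 x2 x3,
    trip (inU t x1) (inU t x2) (inU t x3) = inU t (t x1 x2 x3) }.

(* Main.v *)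
Require Import Defs.
From mathcomp Require Import all_boot all_order all_algebra.
From mathcomp Require Import boolp functions.
Set Implicit Arguments.
Unset Strict Implicit.
Unset Printing Implicit Defensive.
Import GRing.Theory.
Local Open Scope ring_scope.

(** Write L and K for the operators of a (1,1) Freudenthal-Kantor triple system
    and let M, N, P range over K(U,U). The second defining identity is linear in
    K(u,v), so it reads
      K(Mx, y) = L(y, x) M - M L(x, y)
    ([opK_Ml]). The proof rests on the observation that a product of two elements
    of K(U,U) is a sum of operators L:
      M K(c, d) = L(Md, c) - L(Mc, d),     K(c, d) M = L(d, Mc) - L(c, Md)
    ([comp_M_opK], [comp_opK_M]). This reflects the 5-graded Lie algebra attached
    to the system, where K(U,U) sits in degrees 2 and -2 and brackets of these two
    pieces fall in degree 0, which is spanned by pairs formed by L(x, y) and, up to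
    sign, L(y, x).

    Multiplying these two formulas by a third element of K(U,U) and applying the
    identity for K(Mx, y) once more gives
      M K(c, d) P + P K(c, d) M = K(Pc, Md) - K(Pd, Mc)
    ([opK_comp_sandwich]). Hence MNP + PNM is again in K(U,U), which is what
    makes the triple product on three elements of K(U,U) well defined. In the
    same way a product of two elements acts, up to signs and the order of the
    factors, as a derivation of K ([opK_comp_derivation]) and of the triple
    product ([trip_comp_derivation]).

    The operations on the direct sum then have a closed formula on pairs, and
    multilinearity makes them the only ones with the prescribed values. Each of
    the axioms (D1)-(D5), read componentwise and with elements of K(U,U) applied
    to a vector, is a sum of instances of the identities above: an equality in
    the abelian group U, left to a decision procedure. *)

(** * Equalities in abelian groups *)

Inductive zexpr :=
  | ZVar of nat | ZZero | ZOpp of zexpr | ZAdd of zexpr & zexpr.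

Section Abelian.
Variable V : zmodType.

Fixpoint zeval (env : seq V) e : V :=
  match e with
  | ZVar k => env`_k
  | ZZero => 0
  | ZOpp a => - zeval env a
  | ZAdd a b => zeval env a + zeval env b
  end.

Fixpoint zcoef (i : nat) e : int :=
  match e with
  | ZVar k => Posz (k == i)
  | ZZero => 0
  | ZOpp a => - zcoef i a
  | ZAdd a b => zcoef i a + zcoef i b
  end.

Lemma zeval_coef env e :
  zeval env e = \sum_(i < size env) env`_i *~ zcoef i e.
Proof.
elim: e => [k||a IHa|a IHa b IHb] /=.
- case: (ltnP k (size env)) => hk.
    rewrite (bigD1 (Ordinal hk)) //= eqxx big1 ?addr0 // => i /negPf hi.
    by rewrite eq_sym -[k]/(val (Ordinal hk)) val_eqE hi mulr0z.
  rewrite nth_default // big1 // => i _.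
  rewrite gtn_eqF ?mulr0z //; exact: leq_trans (ltn_ord i) hk.
- by rewrite big1 // => i _; rewrite mulr0z.
- by rewrite IHa -sumrN; apply: eq_bigr => i _; rewrite mulrNz.
- by rewrite IHa IHb -big_split; apply: eq_bigr => i _; rewrite mulrzDr.
Qed.

(** Evaluation only depends on the integer coefficients of the finitely many
    atoms, so equality of two expressions is decided by computation. *)
Lemma zeval_eq env e1 e2 :
  all (fun i => zcoef i e1 == zcoef i e2) (iota 0 (size env)) ->
  zeval env e1 = zeval env e2.
Proof.
move=> /allP h; rewrite !zeval_coef; apply: eq_bigr => i _; congr (_ *~ _).
by apply: eqP (h _ _); rewrite mem_iota add0n ltn_ord.
Qed.

(** This turns an equation into a summand of a goal: used repeatedly, it reduces a
    goal that is a signed sum of known equations to an identity that holds in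
    every abelian group. *)
Lemma eq_of_add_eq (a b l r : V) : a = b -> l + b = r + a -> l = r.
Proof. by move=> ->; apply: addIr. Qed.

End Abelian.

Ltac zmem x env :=
  match env with
  | nil => constr:(false)
  | x :: _ => constr:(true)
  | _ :: ?r => zmem x r
  end.
Ltac zatoms env e :=
  lazymatch e with
  | @GRing.add _ ?a ?b => let env := zatoms env a in zatoms env b
  | @GRing.opp _ ?a => zatoms env a
  | @GRing.zero _ => env
  | ?x => lazymatch zmem x env with
          | true => env
          | false => constr:(x :: env)
          end
  end.
Ltac zindex x env :=
  match env with
  | x :: _ => constr:(0%N)
  | _ :: ?r => let n := zindex x r in constr:(S n)
  end.
Ltac zreify env e :=
  lazymatch e with
  | @GRing.add _ ?a ?b =>
      let a := zreify env a in let b := zreify env b in constr:(ZAdd a b)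
  | @GRing.opp _ ?a => let a := zreify env a in constr:(ZOpp a)
  | @GRing.zero _ => constr:(ZZero)
  | ?x => let n := zindex x env in constr:(ZVar n)
  end.
Ltac abel :=
  lazymatch goal with |- @eq ?T ?a ?b =>
    let env := zatoms (@nil T) a in let env := zatoms env b in
    let ea := zreify env a in let eb := zreify env b in
    refine (@zeval_eq _ env ea eb _); vm_compute; reflexivity
  end.

(** * Operators of a Freudenthal-Kantor triple system *)

Section LinearFunction.
Variables (F : fieldType) (V W : lmodType F) (f : V -> W).
Hypothesis lin_f : linear f.

Lemma linear_funD : {morph f : x y / x + y}.
Proof. by move=> x y; have := lin_f 1 x y; rewrite !scale1r. Qed.

Lemma linear_fun0 : f 0 = 0.
Proof. by have := lin_f (-1) 0 0; rewrite !scaleN1r oppr0 addr0 addNr. Qed.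

Lemma linear_funZ a : {morph f : x / a *: x}.
Proof. by move=> x; have := lin_f a x 0; rewrite linear_fun0 !addr0. Qed.

Lemma linear_funN : {morph f : x / - x}.
Proof. by move=> x; rewrite -scaleN1r linear_funZ scaleN1r. Qed.

End LinearFunction.

Section FreudenthalKantor.
Variables (F : fieldType) (U : lmodType F) (t : U -> U -> U -> U).
Hypothesis ht : is_FK11 t.

Local Notation K := (opK t).
Local Notation KU := (K_space t).
Implicit Types (a b c d u v w x y z : U) (A B C D M N P Q : KU).

Let t3 := FK11_trilinear ht.

Lemma tripDl y z : {morph (fun x => t x y z) : a b / a + b}.
Proof. by case: t3 => h _ _; apply: linear_funD. Qed.
Lemma tripDm x z : {morph (fun y => t x y z) : a b / a + b}.
Proof. by case: t3 => _ h _; apply: linear_funD. Qed.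
Lemma tripDr x y : {morph t x y : a b / a + b}.
Proof. by case: t3 => _ _ h; apply: linear_funD. Qed.
Lemma tripNl y z : {morph (fun x => t x y z) : a / - a}.
Proof. by case: t3 => h _ _; apply: linear_funN. Qed.
Lemma tripNm x z : {morph (fun y => t x y z) : a / - a}.
Proof. by case: t3 => _ h _; apply: linear_funN. Qed.
Lemma tripNr x y : {morph t x y : a / - a}.
Proof. by case: t3 => _ _ h; apply: linear_funN. Qed.
Lemma tripZl (k : F) y z : {morph (fun x => t x y z) : a / k *: a}.
Proof. by case: t3 => h _ _; apply: linear_funZ. Qed.
Lemma tripZm (k : F) x z : {morph (fun y => t x y z) : a / k *: a}.
Proof. by case: t3 => _ h _; apply: linear_funZ. Qed.
Lemma tripZr (k : F) x y : {morph t x y : a / k *: a}.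
Proof. by case: t3 => _ _ h; apply: linear_funZ. Qed.

Lemma KspD M : {morph M : x y / x + y}.
Proof. exact: linear_funD (K_space_linear M t3). Qed.
Lemma KspN M : {morph M : x / - x}.
Proof. exact: linear_funN (K_space_linear M t3). Qed.
Lemma KspZ M (k : F) : {morph M : x / k *: x}.
Proof. exact: (linear_funZ (K_space_linear M t3) k). Qed.
Lemma Ksp_add M N z : (M + N) z = M z + N z. Proof. by []. Qed.
Lemma Ksp_opp M z : (- M) z = - M z. Proof. by []. Qed.
Lemma Ksp_zero z : (0 : KU) z = 0. Proof. by []. Qed.
Lemma fun_add (f g : U -> U) z : (f + g) z = f z + g z. Proof. by []. Qed.
Lemma fun_opp (f : U -> U) z : (- f) z = - f z. Proof. by []. Qed.
Lemma fun_zero z : (0 : U -> U) z = 0. Proof. by []. Qed.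
Lemma opKs_val x y z : opKs t x y z = K x y z. Proof. by []. Qed.
Lemma opKE x y z : K x y z = t x z y - t y z x. Proof. by []. Qed.

(** Rewriting with these equations turns a vector built from the triple product
    and from elements of K(U,U) into a signed sum of terms without inner sums,
    where every K(x, y) has been expanded. *)
Definition addE := (tripDl, tripDm, tripDr, tripNl, tripNm, tripNr, KspD, KspN,
  Ksp_add, Ksp_opp, Ksp_zero, fun_add, fun_opp, fun_zero, compE, opKs_val,
  opKE).

Lemma opKC x y z : K x y z = - K y x z.
Proof. by rewrite /opK opprB. Qed.
Lemma opKDl x x' y z : K (x + x') y z = K x y z + K x' y z.
Proof. rewrite !addE; abel. Qed.
Lemma opKZl (k : F) x y z : K (k *: x) y z = k *: K x y z.
Proof. by rewrite /opK tripZl tripZr scalerBr. Qed.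
Lemma opKD x y z z' : K x y (z + z') = K x y z + K x y z'.
Proof. exact: (KspD (opKs t x y)). Qed.
Lemma opKZ (k : F) x y z : K x y (k *: z) = k *: K x y z.
Proof. exact: (KspZ (opKs t x y) k). Qed.

Lemma K_space_ext M N : (forall z, M z = N z) -> M = N.
Proof. by move=> h; apply/val_inj/funext. Qed.

(** A property of functions, not of elements of the span, because the induction
    passes through sums and multiples taken in the space of all functions. *)
Lemma K_space_ind (p : (U -> U) -> Prop) :
  (forall f g, p f -> p g -> p (f + g)) ->
  (forall k f, p f -> p (k *: f)) ->
  (forall x y, p (K x y)) -> forall M, p M.
Proof.
move=> pD pZ pK [f /= /asboolP[n [a [x [y ->]]]]].
elim/big_ind: _ => [|f1 f2|i _]; [|exact: pD|exact/pZ/pK].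
by rewrite -(scale0r (K 0 0)); apply/pZ/pK.
Qed.

Lemma tripLL u v x y z :
  t u v (t x y z) = t (t u v x) y z + t x (t v u y) z + t x y (t u v z).
Proof.
have /(congr1 (fun f => f z)) := FK11_LL ht x y u v.
by rewrite /opL /= => /eqP; rewrite subr_eq => /eqP.
Qed.

(** The second defining identity is linear in the operator K(u, v), hence holds
    for every element of the span. *)
Lemma opK_Ml M x y z : K (M x) y z = t y x (M z) - M (t x y z).
Proof.
move: x y z; pattern (K_space_val M); apply: K_space_ind.
- move=> f g hf hg x y z; rewrite !fctE opKDl hf hg tripDr; abel.
- by move=> k f hf x y z; rewrite !fctE opKZl hf tripZr scalerBr.
- move=> u v x y z.
  by have /(congr1 (fun f => f z)) := FK11_KL ht x y u v.
Qed.

(** Both sides compute L(v, u) K(x, y) - K(x, y) L(u, v): the left one by the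
    second defining identity, the right one by the first. *)
Lemma opK_opKl x y u v z :
  K (K x y u) v z = K (t v u x) y z + K x (t v u y) z.
Proof.
rewrite (opK_Ml (opKs t x y)) !opKs_val /opK !(tripDr, tripNr).
rewrite (tripLL v u x) (tripLL v u y); abel.
Qed.

(** * Products of two elements of the span *)

Lemma comp_M_opK M c d z : M (K c d z) = t (M d) c z - t (M c) d z.
Proof.
(* M moves past any triple product at the cost of terms without outer M. *)
have h x y w : M (t x y w) = t y x (M w) - t (M x) w y + t y w (M x).
  rewrite -[t y x _](subrK (M (t x y w))) -opK_Ml /opK; abel.
rewrite {1}/opK KspD KspN !h; abel.
Qed.

(** For M = K(a, b) the product can be computed by [comp_M_opK], with K(c, d) as
    the left factor; the result takes the stated form because the commutator of
    two operators L is antisymmetric, which by the first defining identity gives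
      L(L(x,y)u, v) + L(u, L(y,x)v) + L(L(u,v)x, y) + L(x, L(v,u)y) = 0. *)
Lemma comp_opK_M M c d z : K c d (M z) = t d (M c) z - t c (M d) z.
Proof.
move: c d z; pattern (K_space_val M); apply: K_space_ind.
- move=> f g hf hg c d z; rewrite !fctE opKD hf hg !tripDm; abel.
- move=> k f hf c d z.
  by rewrite !fctE opKZ hf !tripZm scalerBr.
move=> a b c d z; rewrite -[K c d _]opKs_val comp_M_opK.
(* Two instances of the antisymmetry above, exchanged by c <-> d. *)
apply: eq_of_add_eq (esym (tripLL c b d a z)) _.
apply: eq_of_add_eq (esym (tripLL d a c b z)) _.
apply: eq_of_add_eq (tripLL d b c a z) _.
apply: eq_of_add_eq (tripLL c a d b z) _.
rewrite !addE; abel.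
Qed.

(** After both products with K(c, d) are replaced by operators L, the terms group
    into two instances of L(y, x) P - P L(x, y) = K(Px, y). *)
Lemma opK_comp_sandwich M P c d z :
  M (K c d (P z)) + P (K c d (M z)) = K (P c) (M d) z - K (P d) (M c) z.
Proof. rewrite comp_M_opK comp_opK_M !opK_Ml !(KspD, KspN); abel. Qed.

(** Expanding the right side by [opK_Ml] leaves P on the left or on the right of
    the differences of operators L that equal Q K(x, y) and K(x, y) Q. *)
Lemma opK_comp_derivation P Q x y z :
  P (Q (K x y z)) + K x y (Q (P z)) = K (P (Q x)) y z + K x (P (Q y)) z.
Proof.
rewrite comp_M_opK comp_opK_M [K x (P _) z]opKC !opK_Ml !(KspD, KspN); abel.
Qed.

(** Sliding P and then Q through L(x, y) leaves the correction terms Q K(y, Px)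
    and K(x, Qy) P, which are differences of operators L by [comp_M_opK] and
    [comp_opK_M] and share the
    summand L(Qy, Px) with opposite signs. *)
Lemma trip_comp_derivation P Q x y z :
  Q (P (t x y z)) = t (Q (P x)) y z - t x (P (Q y)) z + t x y (Q (P z)).
Proof.
have slide M a b w : M (t a b w) = t b a (M w) - K (M a) b w.
  by rewrite opK_Ml opprB addrC subrK.
rewrite slide KspD KspN slide [K (P x) y z]opKC [K (Q y) x _]opKC KspN.
by rewrite comp_M_opK comp_opK_M; abel.
Qed.

(** The case N = K(c, d) is [opK_comp_sandwich], and the statement is linear in
    N. *)
Lemma sandwich_in_K_span M N P :
  (M \o N \o P) + (P \o N \o M) \in K_span t.
Proof.
pattern (K_space_val N); apply: K_space_ind.
- move=> f g hf hg.
  suff -> : (M \o (f + g) \o P) + (P \o (f + g) \o M)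
    = ((M \o f \o P) + (P \o f \o M)) + ((M \o g \o P) + (P \o g \o M)).
    exact: rpredD.
  by apply/funext => z; rewrite !fctE !KspD; abel.
- move=> k f hf.
  suff -> : (M \o (k *: f) \o P) + (P \o (k *: f) \o M)
    = k *: ((M \o f \o P) + (P \o f \o M)) by exact: rpredZ.
  by apply/funext => z; rewrite !fctE !KspZ scalerDr.
move=> c d.
suff -> : (M \o K c d \o P) + (P \o K c d \o M)
  = K (P c) (M d) - K (P d) (M c) by rewrite rpredB ?opK_in_K_span.
by apply/funext => z; exact: opK_comp_sandwich.
Qed.

Definition sandwich M N P : KU := KSpace (sandwich_in_K_span M N P).

Lemma sandwich_val M N P z : sandwich M N P z = M (N (P z)) + P (N (M z)).
Proof. by []. Qed.

(** * The operations on the direct sum *)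

Definition fk_bar (p : KU * U) : KU * U := (p.1, - p.2).

Definition fk_star (p q : KU * U) : KU * U :=
  (- opKs t p.2 q.2, p.1 q.2 - q.1 p.2).

Definition fk_trip (p q r : KU * U) : KU * U :=
  (opKs t (r.1 p.2) q.2 - sandwich p.1 q.1 r.1,
   q.1 (p.1 r.2) + t p.2 q.2 r.2).

Lemma FK_operations_exist : is_FK_operations fk_bar fk_star fk_trip.
Proof.
have scDr (k : F) a b : k *: (a + b) = k *: a + k *: b by exact: scalerDr.
have scNr (k : F) a : k *: (- a) = - (k *: a) by exact: scalerN.
have Ksp_scale (k : F) M z : (k *: M) z = k *: M z by [].
have fun_scale (k : F) (f : U -> U) z : (k *: f) z = k *: f z by [].
have valE M : \val M = M :> (U -> U) by [].
have scE := (Ksp_scale, fun_scale, KspZ, tripZl, tripZm, tripZr, scDr, scNr).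
have Ksp0 M : M 0 = 0 := linear_fun0 (K_space_linear M t3).
have [tl tm tr] := t3.
have t0l y z : t 0 y z = 0 := linear_fun0 (tl y z).
have t0m x z : t x 0 z = 0 := linear_fun0 (tm x z).
have t0r x y : t x y 0 = 0 := linear_fun0 (tr x y).
have zeroE := (Ksp0, t0l, t0m, t0r).
split.
- move=> k [M x] [N y]; congr (_, _) => /=.
  by rewrite opprD scalerN.
- by split=> [[P z] | [P z]] k [M x] [N y]; congr (_, _) => /=;
    try apply: K_space_ext => w; rewrite !(addE, scE); abel.
- by split=> [[P z] [Q w] | [P z] [Q w] | [P z] [Q w]] k [M x] [N y];
    congr (_, _) => /=; try apply: K_space_ext => s;
    rewrite !(addE, scE, sandwich_val, valE); abel.
- by move=> M; congr (_, _) => /=; rewrite oppr0.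
- by [].
all: try by move=> *; congr (_, _) => /=; try apply: K_space_ext => w;
  rewrite !(addE, zeroE, sandwich_val); abel.
move=> M1 M2 M3; exists (- sandwich M1 M2 M3) => //.
by congr (_, _) => /=; try apply: K_space_ext => w;
  rewrite !(addE, zeroE, sandwich_val); abel.
Qed.

Lemma FK_operations_unique bar star trip :
  @is_FK_operations F U t bar star trip ->
  [/\ bar = fk_bar, star = fk_star & trip = fk_trip].
Proof.
move=> h; have h' := FK_operations_exist.
have split_pair (p : KU * U) : p = inK p.1 + inU t p.2.
  by case: p => M x; congr (_, _); rewrite /= ?addr0 ?add0r.
have eq_on_summands f g (p : KU * U) : linear f -> linear g ->
    (forall M, f (inK M) = g (inK M)) ->
    (forall x, f (inU t x) = g (inU t x)) -> f p = g p :> KU * U.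
  move=> lf lg eK eU.
  by rewrite [p]split_pair (linear_funD lf) (linear_funD lg) eK eU.
have [sl sr] := FKop_star_bilinear h; have [sl' sr'] := FKop_star_bilinear h'.
have [tl tm tr] := FKop_trip_trilinear h.
have [tl' tm' tr'] := FKop_trip_trilinear h'.
split.
- apply/funext => p; apply: eq_on_summands.
  + exact: FKop_bar_linear h.
  + exact: FKop_bar_linear h'.
  + by move=> M; rewrite (FKop_bar_K h) (FKop_bar_K h').
  + by move=> x; rewrite (FKop_bar_U h) (FKop_bar_U h').
- apply/funext => p; apply/funext => q.
  apply: (eq_on_summands (star^~ q) (fk_star^~ q)) => // [M | x];
    apply: eq_on_summands => // [N | y].
  + by rewrite (FKop_star_KK h) (FKop_star_KK h').
  + by rewrite (FKop_star_KU h) (FKop_star_KU h').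
  + by rewrite (FKop_star_UK h) (FKop_star_UK h') (FKop_star_KU h)
      (FKop_star_KU h').
  + by rewrite (FKop_star_UU h) (FKop_star_UU h').
apply/funext => p; apply/funext => q; apply/funext => r.
apply: (eq_on_summands (fun p => trip p q r) (fun p => fk_trip p q r))
  => // [M1 | x1];
  apply: (eq_on_summands (fun q => trip _ q r) (fun q => fk_trip _ q r))
  => // [M2 | x2];
  apply: eq_on_summands => // [M3 | x3].
- have [N1 -> e1] := FKop_trip_KKK h M1 M2 M3.
  have [N2 -> e2] := FKop_trip_KKK h' M1 M2 M3.
  by congr inK; apply: val_inj; rewrite /= e1 e2.
- by rewrite (FKop_trip_KKU h) (FKop_trip_KKU h').
- by rewrite (FKop_trip_KUK h) (FKop_trip_KUK h').
- by rewrite (FKop_trip_KUU h) (FKop_trip_KUU h').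
- by rewrite (FKop_trip_UKK h) (FKop_trip_UKK h').
- by rewrite (FKop_trip_UKU h) (FKop_trip_UKU h').
- by rewrite (FKop_trip_UUK h) (FKop_trip_UUK h').
- by rewrite (FKop_trip_UUU h) (FKop_trip_UUU h').
Qed.

(** * The axioms of a dicyclic ternary algebra *)

Lemma FK_operations_dicyclic :
  is_dicyclic_ternary_algebra fk_bar fk_star fk_trip.
Proof.
have hop := FK_operations_exist.
split.
- exact: FKop_bar_linear hop.
- exact: FKop_star_bilinear hop.
- move=> [M x] [N y]; congr (_, _) => /=; last by rewrite opprB.
  by apply: K_space_ext => z; rewrite !addE; abel.
- exact: FKop_trip_trilinear hop.
- by move=> [M x]; rewrite /fk_bar /= opprK.
- move=> [M x] [N y]; congr (_, _) => /=; last by rewrite !addE; abel.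
  by apply: K_space_ext => z; rewrite !addE; abel.
- move=> [M x] [N y] [P z]; congr (_, _) => /=; last by rewrite !addE; abel.
  by apply: K_space_ext => w; rewrite !addE; abel.
- move=> [A x] [B y] [C z]; congr (_, _) => /=.
    by apply: K_space_ext => w; rewrite !(addE, sandwich_val); abel.
  by rewrite !(addE, sandwich_val); abel.
- move=> [P u] [Q v] [M x] [N y]; congr (_, _) => /=.
    (* L(v, u) and PQ both act on K(x, y) as derivations. *)
    apply: K_space_ext => w.
    apply: eq_of_add_eq (opK_opKl x y u v w) _.
    apply: eq_of_add_eq (opK_comp_derivation P Q x y w) _.
    rewrite !(addE, sandwich_val); abel.
  apply: eq_of_add_eq (opK_Ml M v u y) _.
  apply: eq_of_add_eq (esym (opK_Ml N v u x)) _.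
  rewrite !(addE, sandwich_val); abel.
- move=> [A x] [B y] [C z] [D w]; congr (_, _) => /=.
    (* The sandwiches of D with A, B and C produce the remaining terms, which
       then cancel in the cyclic sum. *)
    apply: K_space_ext => s.
    apply: eq_of_add_eq (opK_comp_sandwich A D y z s) _.
    apply: eq_of_add_eq (opK_comp_sandwich B D z x s) _.
    apply: eq_of_add_eq (opK_comp_sandwich C D x y s) _.
    rewrite !(addE, sandwich_val); abel.
  apply: eq_of_add_eq (esym (comp_opK_M A y z w)) _.
  apply: eq_of_add_eq (esym (comp_opK_M B z x w)) _.
  apply: eq_of_add_eq (esym (comp_opK_M C x y w)) _.
  rewrite !(addE, sandwich_val); abel.
- move=> [A x] [B y] [C z] [D w]; congr (_, _) => /=.
    (* DC, DA and DB act as derivations, and the cyclic sum cancels because K is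
       antisymmetric. *)
    apply: K_space_ext => s.
    apply: eq_of_add_eq (opK_comp_derivation D C x y s) _.
    apply: eq_of_add_eq (opK_comp_derivation D A y z s) _.
    apply: eq_of_add_eq (opK_comp_derivation D B z x s) _.
    rewrite !(addE, sandwich_val); abel.
  apply: eq_of_add_eq (esym (comp_M_opK C x y w)) _.
  apply: eq_of_add_eq (esym (comp_M_opK A y z w)) _.
  apply: eq_of_add_eq (esym (comp_M_opK B z x w)) _.
  rewrite !(addE, sandwich_val); abel.
- move=> [P u] [Q v] [A x] [B y] [C z]; congr (_, _) => /=.
    (* Products of five elements of the span cancel. The terms in P, Q, C, x, y
       need the derivation PQ, those in C, u, v, x, y need L(v, u), and those in
       A, B, C, u, v need the derivations CB and AB together with the sandwich of
       K(Bv, u) by A and C. *)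
    apply: K_space_ext => w.
    have KKC : K (K (C u) v x) y w = K (t v u (C x)) y w - K (C (t u v x)) y w.
      by rewrite (opK_Ml C) !addE; abel.
    apply: eq_of_add_eq (esym (opK_comp_derivation P Q (C x) y w)) _.
    apply: eq_of_add_eq (opK_opKl (C x) y u v w) _.
    apply: eq_of_add_eq (esym KKC) _.
    apply: eq_of_add_eq (opK_comp_derivation C B (A u) v w) _.
    apply: eq_of_add_eq (opK_comp_derivation A B (C u) v w) _.
    apply: eq_of_add_eq (opK_comp_sandwich A C (B v) u w) _.
    rewrite !(addE, sandwich_val); abel.
  (* QP and L(u, v) act as derivations; what is left is the commutation of
     L(u, v) past BA. *)
  have BKA : B (K (A u) v z) = B (t v u (A z)) - B (A (t u v z)).
    by rewrite (opK_Ml A) KspD KspN.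
  apply: eq_of_add_eq (trip_comp_derivation P Q x y z) _.
  apply: eq_of_add_eq (tripLL u v x y z) _.
  apply: eq_of_add_eq (esym (opK_Ml B v u (A z))) _.
  apply: eq_of_add_eq (esym BKA) _.
  rewrite !(addE, sandwich_val); abel.
Qed.

End FreudenthalKantor.

(* The first conjunct says that the operations are well defined; they are
   then unique, being determined by their values on the summands. *)
Theorem theorem7p4 (F : fieldType)
    (hchar2 : 2%N \notin [pchar F]) (hchar3 : 3%N \notin [pchar F])
    (U : lmodType F) (t : U -> U -> U -> U) (ht : is_FK11 t) :
  (exists bar star trip, @is_FK_operations F U t bar star trip) /\
  (forall bar star trip, @is_FK_operations F U t bar star trip ->
     is_dicyclic_ternary_algebra bar star trip).
Proof.
split; first by exists (fk_bar (t := t)), (fk_star (t := t)), (fk_trip ht);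
  exact: FK_operations_exist.
move=> bar star trip /(FK_operations_unique ht)[-> -> ->].
exact: FK_operations_dicyclic.
Qed.
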